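(* The problem $\textsc{ssmSAT}[\mathfrak{S}_{\mathrm{ti}}\cap\mathfrak{S}_{\mathrm{diag}}]$ is undecidable: there is no algorithm that, given an SSM $\mathcal{S}$ over a finite alphabet $\Sigma$ which is both time-invariant and diagonal (evaluated with exact real arithmetic), decides whether there is a word $w\in\Sigma^*$ with $\mathcal{S}(w)=1$.
   Context: A feedforward neural network (FNN) is a composition of layers of nodes, each node computing $\mathbf{x}\mapsto\mathit{relu}(\sum_i c_ix_i+b)$ with $\mathit{relu}(x)=\max(0,x)$. An SSM layer of dimension $d$ is a tuple $(\mathbf{h}_0,\mathit{gate},\mathit{inc},\phi)$ with $\mathbf{h}_0\in\mathbb{R}^d$, $\mathit{gate}\colon\mathbb{R}^d\to\mathbb{R}^{d\times d}$, $\mathit{inc}\colon\mathbb{R}^d\to\mathbb{R}^d$, $\phi\colon\mathbb{R}^d\times\mathbb{R}^d\to\mathbb{R}^d$ (computed by an FNN); on input $\mathbf{x}_1\cdots\mathbf{x}_k$ it computes $\mathbf{h}_t=\mathit{gate}(\mathbf{x}_t)\mathbf{h}_{t-1}+\mathit{inc}(\mathbf{x}_t)$ ($1\le t\le k$) and outputs $\mathbf{z}_t=\phi(\mathbf{h}_t,\mathbf{x}_t)$. An SSM over a finite alphabet $\Sigma$ with $L$ layers is a tuple $(\mathit{emb},l_1,\dots,l_L,\mathit{out})$ with $\mathit{emb}\colon\Sigma\to\mathbb{R}^d$, SSM layers $l_j$, and $\mathit{out}$ computed by an FNN; on $w=a_1\cdots a_k$ it sets $\mathbf{x}^0_i=\mathit{emb}(a_i)$,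 lets each layer $l_j$ map $\mathbf{x}^{j-1}_1\cdots\mathbf{x}^{j-1}_k$ to $\mathbf{x}^{j}_1\cdots\mathbf{x}^{j}_k$, and outputs $\mathcal{S}(w)=\mathit{out}(\mathbf{x}^L_k)$. All weights and constants are finitely represented. $\mathfrak{S}_{\mathrm{ti}}$ (time-invariant SSM) is the class of SSM in which every $\mathit{gate}$ is a constant matrix; $\mathfrak{S}_{\mathrm{diag}}$ (diagonal SSM) is the class in which every $\mathit{gate}(\mathbf{x})$ is a diagonal matrix for all $\mathbf{x}$. *)

(* Defs.v *)
From Stdlib Require List.
From HB Require Import structures.
From mathcomp Require Import all_boot all_order all_algebra.
From mathcomp Require Import reals.

Set Implicit Arguments.
Unset Strict Implicit.
Unset Printing Implicit Defensive.

Import Order.TTheory GRing.Theory Num.Theory.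
Local Open Scope ring_scope.

(** * Partial recursive functions *)

Inductive recfun : nat -> Type :=
| RZero k : recfun k
| RSucc : recfun 1
| RProj k of 'I_k : recfun k
| RComp k m of recfun m & ('I_m -> recfun k) : recfun k
| RPrec k of recfun k & recfun k.+2 : recfun k.+1
| RMu k of recfun k.+1 : recfun k.

(* [computes f v y]: f is defined on v, with value y.  In the RPrec case s is
   the sequence of intermediate values s 0, ..., s (thead v); in the RMu case
   f must be defined (and nonzero) at every argument below the minimum. *)
Fixpoint computes k (f : recfun k) : k.-tuple nat -> nat -> Prop :=
  match f in recfun k return k.-tuple nat -> nat -> Prop with
  | RZero _ => fun _ y => y = 0%N
  | RSucc => fun v y => y = (thead v).+1
  | RProj _ i => fun v y => y = tnth v i
  | RComp _ m f g => fun v y =>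
      exists w : m.-tuple nat,
        (forall i, computes (g i) v (tnth w i)) /\ computes f w y
  | RPrec _ f g => fun v y =>
      exists s : nat -> nat,
        [/\ computes f [tuple of behead v] (s 0%N),
            forall i, (i < thead v)%N ->
              computes g [tuple of i :: s i :: behead v] (s i.+1)
          & y = s (thead v)]
  | RMu _ f => fun v y =>
      (forall i, (i < y)%N -> exists z, computes f [tuple of i :: v] z.+1) /\
      computes f [tuple of y :: v] 0%N
  end.

(* The instances of the problem are the x : T with [C x]; an algorithm is given
   the code of an instance and may do anything on other inputs. *)
Definition decides (T : Type) (code : T -> nat) (C P : T -> Prop)
    (f : recfun 1) : Prop :=
  forall x, C x ->
    (P x -> computes f [tuple code x] 1%N) /\
    (~ P x -> computes f [tuple code x] 0%N).

Definition decidable_problem (T : Type) (code : T -> nat) (C P : T -> Prop) :=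
  exists f : recfun 1, decides code C P f.

(** * Finite descriptions of networks and SSM, with rational weights *)

(* Feedforward networks with m inputs and n outputs, and at least one layer.
   A layer with p nodes on m inputs is given by its weights and biases. *)
Inductive fnn (m n : nat) : Type :=
| FOut of 'M[rat]_(n, m) & 'cV[rat]_n
| FHid p of 'M[rat]_(p, m) & 'cV[rat]_p & fnn p n.

Record ssm_layer (d : nat) := SSMLayer {
  h0 : 'cV[rat]_d;
  gate_net : fnn d (d * d);
  inc_net : fnn d d;
  phi_net : fnn (d + d) d }.

(* The alphabet is {0, ..., alph - 1}. *)
Record ssm := SSM {
  alph : nat;
  dim : nat;
  emb : {ffun 'I_alph -> 'cV[rat]_dim};
  layers : seq (ssm_layer dim);
  out_net : fnn dim 1 }.

(** * Semantics over the real numbers *)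

(* ORelu: the output nodes apply relu, like all the other nodes of an FNN.
   OId: the output nodes do not apply it; this yields in particular all affine
   maps, and constants of arbitrary sign. *)
Variant output_kind := ORelu | OId.

Section Semantics.
Variable R : realType.

Definition relu (x : R) : R := Num.max 0 x.

Definition affine m n (A : 'M[rat]_(n, m)) (b : 'cV[rat]_n) (x : 'cV[R]_m) :
  'cV[R]_n := map_mx ratr A *m x + map_mx ratr b.

Fixpoint net_eval (o : output_kind) m n (N : fnn m n) : 'cV[R]_m -> 'cV[R]_n :=
  match N with
  | FOut A b => fun x =>
      if o is ORelu then map_mx relu (affine A b x) else affine A b x
  | FHid _ A b N' => fun x => net_eval o N' (map_mx relu (affine A b x))
  end.

Definition fnn_eval := net_eval ORelu.

Variable o : output_kind.

Definition gate d (l : ssm_layer d) (x : 'cV[R]_d) : 'M[R]_d :=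
  vec_mx (net_eval o (gate_net l) x)^T.

Definition inc d (l : ssm_layer d) (x : 'cV[R]_d) : 'cV[R]_d :=
  net_eval o (inc_net l) x.

Definition phi d (l : ssm_layer d) (h x : 'cV[R]_d) : 'cV[R]_d :=
  fnn_eval (phi_net l) (col_mx h x).

Fixpoint layer_from d (l : ssm_layer d) (h : 'cV[R]_d) (xs : seq 'cV[R]_d) :
    seq 'cV[R]_d :=
  if xs is x :: xs' then
    let h' := gate l x *m h + inc l x in phi l h' x :: layer_from l h' xs'
  else [::].

Definition layer_run d (l : ssm_layer d) (xs : seq 'cV[R]_d) : seq 'cV[R]_d :=
  layer_from l (map_mx ratr (h0 l)) xs.

(* The output is read off the last position, so it is undefined on the empty
   word. *)
Definition ssm_value (S : ssm) (w : seq 'I_(alph S)) : option R :=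
  let xs := [seq map_mx ratr (emb S a) | a <- w] in
  let zs := foldl (fun ys l => layer_run l ys) xs (layers S) in
  if zs is z :: zs' then Some (fnn_eval (out_net S) (last z zs') 0 0) else None.

Definition time_invariant (S : ssm) : Prop :=
  List.Forall (fun l => exists A : 'M[R]_(dim S), forall x, gate l x = A)
    (layers S).

Definition diagonal (S : ssm) : Prop :=
  List.Forall (fun l => forall x, is_diag_mx (gate l x)) (layers S).

Definition ssm_sat (S : ssm) : Prop :=
  exists w : seq 'I_(alph S), ssm_value w = Some 1.

End Semantics.

(** * Goedel numbering *)

Definition code_int (z : int) : nat :=
  match z with Posz n => n.*2 | Negz n => n.*2.+1 end.

Definition code_rat (q : rat) : nat :=
  CodeSeq.code [:: code_int (numq q); code_int (denq q)].

Definition code_mx m n (A : 'M[rat]_(m, n)) : nat :=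
  CodeSeq.code
    [seq CodeSeq.code [seq code_rat (A i j) | j <- enum 'I_n] | i <- enum 'I_m].

Fixpoint code_fnn m n (N : fnn m n) : nat :=
  match N with
  | FOut A b => CodeSeq.code [:: code_mx A; code_mx b]
  | FHid p A b N' => CodeSeq.code [:: p; code_mx A; code_mx b; code_fnn N']
  end.

Definition code_layer d (l : ssm_layer d) : nat :=
  CodeSeq.code [:: code_mx (h0 l); code_fnn (gate_net l);
                   code_fnn (inc_net l); code_fnn (phi_net l)].

Definition code_ssm (S : ssm) : nat :=
  CodeSeq.code
    [:: alph S; dim S;
        CodeSeq.code [seq code_mx (emb S a) | a <- enum 'I_(alph S)];
        CodeSeq.code [seq code_layer l | l <- layers S];
        code_fnn (out_net S)].

Lemma code_int_inj : injective code_int.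
Proof.
have par (m n : nat) : m.*2 <> n.*2.+1.
  by move/(congr1 odd); rewrite /= !odd_double.
case=> m [] n /=; first by move/double_inj->.
- by move/par.
- by move/esym/par.
by case=> /double_inj->.
Qed.

Lemma code_rat_inj : injective code_rat.
Proof.
move=> p q /(can_inj CodeSeq.codeK)[/code_int_inj np /code_int_inj dp].
by rewrite -[p]divq_num_den -[q]divq_num_den np dp.
Qed.

Lemma code_mx_inj m n : injective (@code_mx m n).
Proof.
move=> A B /(can_inj CodeSeq.codeK)/eq_in_map eqr; apply/matrixP=> i j.
have /(can_inj CodeSeq.codeK)/eq_in_map eqc := eqr i (mem_enum _ _).
exact: code_rat_inj (eqc j (mem_enum _ _)).
Qed.

Lemma code_fnn_inj m n : injective (@code_fnn m n).
Proof.
elim=> {m n} [m n A b|m n p A b N IH] N1.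
  case: N1 => [A' b'|p' A' b' N'] /(can_inj CodeSeq.codeK) //.
  by case=> /code_mx_inj-> /code_mx_inj->.
case: N1 => [A' b'|p' A' b' N'] /(can_inj CodeSeq.codeK) //.
case=> ep; case: _ / ep A' b' N' => A' b' N'.
by move=> /code_mx_inj-> /code_mx_inj-> /IH->.
Qed.

Lemma code_layer_inj d : injective (@code_layer d).
Proof.
move=> [h g i f] [h' g' i' f'] /(can_inj CodeSeq.codeK) /= [].
by move=> /code_mx_inj-> /code_fnn_inj-> /code_fnn_inj-> /code_fnn_inj->.
Qed.

Lemma code_ssm_inj : injective code_ssm.
Proof.
move=> [s d e ls N] [s' d' e' ls' N'] /(can_inj CodeSeq.codeK) /= [es ed].
case: _ / es e' => e'; case: _ / ed e' ls' N' => e' ls' N'.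
move=> /(can_inj CodeSeq.codeK)/eq_in_map ee.
move=> /(can_inj CodeSeq.codeK)/(inj_map (@code_layer_inj _))-> /code_fnn_inj->.
suff -> : e = e' by [].
by apply/ffunP=> a; apply: code_mx_inj; apply: ee; rewrite mem_enum.
Qed.

Arguments ssm_sat R o S : clear implicits.
Arguments time_invariant R o S : clear implicits.
Arguments diagonal R o S : clear implicits.

(* Main.v *)
From HB Require Import structures.
Require Import Defs.
From mathcomp Require Import all_boot all_order all_algebra.
From mathcomp Require Import reals zify.

(** Letters are the transitions of a counter machine, one-hot encoded.  A first
    layer with identity gate counts the occurrences of every letter; as the
    program counter and the registers are affine functions of these counts, one
    relu network checks that the letter read is enabled.  A second layer counts
    the violations, so that the SSM outputs 1 exactly on the words that are runs
    ending with the halting transition.  The input of the machine is the vector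
    of initial counts.

    Every partial recursive g is compiled to such a machine, and the Goedel
    number of the SSM for g on input v depends on g through six numbers only, by a
    recursive function F of these numbers and v.  If f decided satisfiability,
    take g (c) := f (F (c, c)) and run it on its own six numbers: the SSM is then
    satisfiable iff f answers 0 on it.  Since f is known to answer on this SSM, it
    is enough that the deterministic machine follows the terminating computations
    of g. *)

Set Implicit Arguments.
Unset Strict Implicit.
Unset Printing Implicit Defensive.

Import Order.TTheory GRing.Theory Num.Theory.

(** * Recursive functions for the Goedel numbering *)

Lemma computes_comp1 k (f : recfun 1) (g : recfun k) v x y :
  computes g v x -> computes f [tuple x] y ->
  computes (RComp f (fun _ : 'I_1 => g)) v y.
Proof.
by move=> gx fy; exists [tuple x]; split=> // i; rewrite ord1 tnth0.
Qed.

Definition rec_double : recfun 1 :=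
  RPrec (RZero 0) (RComp RSucc (fun _ : 'I_1 =>
    RComp RSucc (fun _ : 'I_1 => RProj (lift ord0 (ord0 : 'I_1))))).

Lemma computes_double n : computes rec_double [tuple n] n.*2.
Proof.
exists double; split=> // i _.
by apply: computes_comp1; first by apply: computes_comp1; first by [].
Qed.

Definition code_cons a b := 2 ^ a * b.*2.+1.

Lemma code_consE a s : CodeSeq.code (a :: s) = code_cons a (CodeSeq.code s).
Proof. by []. Qed.

Definition rec_code_cons : recfun 2 :=
  RPrec (RComp RSucc (fun _ : 'I_1 => rec_double))
        (RComp rec_double (fun _ : 'I_1 => RProj (lift ord0 (ord0 : 'I_2)))).

Lemma computes_code_cons a b :
  computes rec_code_cons [tuple a; b] (code_cons a b).
Proof.
exists (code_cons^~ b); split=> //.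
  have -> : [tuple of behead [tuple a; b]] = [tuple b] by apply: val_inj.
  by apply: computes_comp1 (computes_double b) _; rewrite /code_cons mul1n.
move=> i _; apply: computes_comp1; first by [].
rewrite (_ : code_cons i.+1 b = (code_cons i b).*2) ?/code_cons.
  exact: computes_double.
by rewrite expnS -mulnA mul2n.
Qed.

(** The arithmetic of Goedel numbers as a syntax, so that a single induction shows every such
    expression to be recursive. *)
Inductive code_expr k :=
| CVar of 'I_k
| CZero
| CSucc of code_expr k
| CDouble of code_expr k
| CCons of code_expr k & code_expr k.

Arguments CZero {k}.

Fixpoint code_eval k (v : k.-tuple nat) (e : code_expr k) : nat :=
  match e with
  | CVar i => tnth v i
  | CZero => 0
  | CSucc e => (code_eval v e).+1
  | CDouble e => (code_eval v e).*2
  | CCons e1 e2 => code_cons (code_eval v e1) (code_eval v e2)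
  end.

Fixpoint code_rec k (e : code_expr k) : recfun k :=
  match e with
  | CVar i => RProj i
  | CZero => RZero k
  | CSucc e => RComp RSucc (fun _ : 'I_1 => code_rec e)
  | CDouble e => RComp rec_double (fun _ : 'I_1 => code_rec e)
  | CCons e1 e2 => RComp rec_code_cons
      (fun i : 'I_2 => if val i is 0 then code_rec e1 else code_rec e2)
  end.

Lemma computes_code_rec k (v : k.-tuple nat) e :
  computes (code_rec e) v (code_eval v e).
Proof.
elim: e => //= [e IH|e IH|e1 IH1 e2 IH2].
- exact: (computes_comp1 (f := RSucc) IH).
- exact: computes_comp1 IH (computes_double _).
exists [tuple code_eval v e1; code_eval v e2]; split.
  by case=> [[|[|]]].
exact: computes_code_cons.
Qed.

(** * Structured counter programs *)

Inductive com :=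
| Inc of nat
| Seq of com & com
| Loop of nat & com.

Definition upd (s : nat -> nat) r x : nat -> nat := fun q => if q == r then x else s q.

Lemma upd_same s r x : upd s r x r = x.
Proof. by rewrite /upd eqxx. Qed.

Lemma upd_other s r x q : q != r -> upd s r x q = s q.
Proof. by rewrite /upd => /negPf->. Qed.

(* [Loop r c] is [while r > 0 do (decrement r; c)]. *)
Inductive exec : com -> (nat -> nat) -> (nat -> nat) -> Prop :=
| ExInc r s : exec (Inc r) s (upd s r (s r).+1)
| ExSeq c1 c2 s1 s2 s3 : exec c1 s1 s2 -> exec c2 s2 s3 -> exec (Seq c1 c2) s1 s3
| ExLoop0 r c s : s r = 0 -> exec (Loop r c) s s
| ExLoopS r c n s1 s2 s3 : s1 r = n.+1 -> exec c (upd s1 r n) s2 ->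
    exec (Loop r c) s2 s3 -> exec (Loop r c) s1 s3.

(** There is no empty command, so the loop body increments a junk register instead. *)
Definition clear r junk := Loop r (Inc junk).

Lemma exec_clear r j s : r != j ->
  exists s', [/\ exec (clear r j) s s', s' r = 0 &
    forall q, q != r -> q != j -> s' q = s q].
Proof.
move=> rj; move: {2}(s r) (erefl (s r)) => n; elim: n s => [|n IH] s sr.
  by exists s; split=> //; apply: ExLoop0.
have [|s' [e z p]] := IH (upd (upd s r n) j (upd s r n j).+1).
  by rewrite upd_other ?upd_same.
exists s'; split=> // [|q qr qj]; first exact: ExLoopS sr (ExInc _ _) e.
by rewrite p ?upd_other.
Qed.

(** Reading a register empties it: [x] is moved to [n], then [n] is emptied back into both [x] and
    [y]. Register [n.+1] is junk. *)
Definition copy x y n :=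
  Seq (clear y n.+1) (Seq (clear n n.+1)
    (Seq (Loop x (Inc n)) (Loop n (Seq (Inc x) (Inc y))))).

Lemma exec_copy x y n s : x < n -> y < n -> x != y ->
  exists s', [/\ exec (copy x y n) s s', s' y = s x &
    forall q, q < n -> q != y -> s' q = s q].
Proof.
move=> xn yn xy.
have move1 t : exists t', [/\ exec (Loop x (Inc n)) t t', t' x = 0,
    t' n = t n + t x & forall q, q != x -> q != n -> t' q = t q].
  move: {2}(t x) (erefl (t x)) => m; elim: m t => [|m IH] t tx.
    by exists t; split; rewrite ?tx ?addn0 //; apply: ExLoop0.
  have [|t' [e zx zn p]] := IH (upd (upd t x m) n (upd t x m n).+1).
    by rewrite upd_other ?upd_same //; lia.
  exists t'; split=> // [| |q qx qn].
  - exact: ExLoopS tx (ExInc _ _) e.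
  - by rewrite zn /upd; do !case: eqP; lia.
  - by rewrite p ?upd_other.
have move2 t : exists t', [/\ exec (Loop n (Seq (Inc x) (Inc y))) t t',
    t' x = t x + t n, t' y = t y + t n &
    forall q, q != x -> q != y -> q != n -> t' q = t q].
  move: {2}(t n) (erefl (t n)) => m; elim: m t => [|m IH] t tn.
    by exists t; split; rewrite ?tn ?addn0 //; apply: ExLoop0.
  set u := upd t n m; set u1 := upd u x (u x).+1; set u2 := upd u1 y (u1 y).+1.
  have [|t' [e zx zy p]] := IH u2; first by rewrite /u2 /u1 /u /upd; do !case: eqP; lia.
  exists t'; split=> // [| | |q qx qy qn].
  - exact: ExLoopS tn (ExSeq (ExInc _ _) (ExInc _ _)) e.
  - by rewrite zx /u2 /u1 /u /upd; do !case: eqP; lia.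
  - by rewrite zy /u2 /u1 /u /upd; do !case: eqP; lia.
  - by rewrite p // /u2 /u1 /u !upd_other.
have [|s1 [e1 z1 p1]] := @exec_clear y n.+1 s; first by lia.
have [|s2 [e2 z2 p2]] := @exec_clear n n.+1 s1; first by lia.
have s2y : s2 y = 0 by rewrite p2 //; lia.
have s2q q : q < n -> q != y -> s2 q = s q.
  by move=> qn qy; rewrite p2 ?p1 //; lia.
have [s3 [e3 x3 n3 p3]] := move1 s2.
have [s4 [e4 x4 y4 p4]] := move2 s3.
exists s4; split.
- by do 3![apply: ExSeq; first by eassumption].
- by rewrite y4 n3 p3 ?s2y ?z2 ?s2q //; lia.
move=> q qn qy; have [-> | qx] := eqVneq q x; first by rewrite x4 x3 n3 z2 s2q.
by rewrite p4 ?p3 ?s2q //; lia.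
Qed.

(* The arguments are in the registers [inp], the value goes to [out], and all
   registers from [n] on are scratch, with arbitrary initial contents. *)
Fixpoint compile k (f : recfun k) (inp : seq nat) (out n : nat) : com :=
  match f with
  | RZero _ => clear out n
  | RSucc => Seq (copy (nth 0 inp 0) out n) (Inc out)
  | RProj _ i => copy (nth 0 inp i) out n
  | RComp _ m f g =>
      foldr Seq (compile f (iota n m) out (n + m))
        [seq compile (g i) inp (n + i) (n + m) | i <- enum 'I_m]
  | RPrec _ f g =>
      let: N := n.+3 in
      Seq (compile f (behead inp) out N) (Seq (clear n N)
        (Seq (copy (nth 0 inp 0) n.+1 N)
          (Loop n.+1 (Seq (compile g [:: n, out & behead inp] n.+2 N)
                          (Seq (copy n.+2 out N) (Inc n))))))
  | RMu _ f =>
      let: N := n.+2 in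
      Seq (clear out N) (Seq (clear n.+1 N) (Seq (Inc n.+1)
        (Loop n.+1 (Seq (compile f (out :: inp) n N)
          (Loop n (Seq (clear n N) (Seq (Inc out) (Inc n.+1))))))))
  end.

(** * Correctness of the compilation *)

Definition compiles k (f : recfun k) := forall v y s inp out n,
  computes f v y -> [seq s r | r <- inp] = v -> all (fun r => r < n) inp ->
  out < n -> out \notin inp ->
  exists s', [/\ exec (compile f inp out n) s s', s' out = y &
    forall r, r < n -> r != out -> s' r = s r].

Lemma compile_prec k (f : recfun k) (g : recfun k.+2) :
  compiles f -> compiles g -> compiles (RPrec f g).
Proof.
move=> IHf IHg v y s [|x inp] out n.
  by move=> _ e; have := size_tuple v; rewrite -e.
move=> /= [u [uf ug ->]] evi /andP[xn inpn] outn.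
rewrite inE negb_or => /andP[outx outi].
have hv : thead v = s x by case: v evi {uf ug} => -[|a w] //= i [-> _].
have bv : [seq s r | r <- inp] = behead v by rewrite -evi.
have inpN : all (fun r => r < n.+3) inp by apply: sub_all inpn => q /= ?; lia.
have [|s1 [e1 o1 p1]] := IHf _ _ s inp out n.+3 uf bv inpN _ outi; first by lia.
have [|s2 [e2 z2 p2]] := @exec_clear n n.+3 s1; first by lia.
have [|||s3 [e3 z3 p3]] := @exec_copy x n.+1 n.+3 s2; try lia.
have keep3 r : r < n -> r != out -> s3 r = s r.
  by move=> rn ro; rewrite p3 ?p2 ?p1 //; lia.
(* Invariant: [n] holds the index [i], [n.+1] the number [m] of iterations left, and [out] the value
   [u i]. *)
have loop m i t : i + m = thead v -> t n.+1 = m -> t n = i -> t out = u i ->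
    (forall r, r < n -> r != out -> t r = s r) ->
    exists t', [/\ exec (Loop n.+1 (Seq (compile g [:: n, out & inp] n.+2 n.+3)
                          (Seq (copy n.+2 out n.+3) (Inc n)))) t t',
      t' out = u (thead v) & forall r, r < n -> r != out -> t' r = s r].
  elim: m i t => [|m IH] i t im tm ti tout tk.
    by exists t; split=> //; [exact: ExLoop0 | rewrite -im addn0].
  have {}ug : computes g [tuple of i :: u i :: behead v] (u i.+1).
    by apply: ug; lia.
  set t0 := upd t n.+1 m.
  have t0k r : r < n.+1 -> t0 r = t r by move=> rn; rewrite /t0 upd_other //; lia.
  have mapt0 : [seq t0 r | r <- [:: n, out & inp]] = [:: i, u i & behead v].
    rewrite /= !t0k ?ti ?tout -?bv; try lia; congr [:: _, _ & _].
    apply/eq_in_map => r ri; have rn := allP inpn _ ri.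
    rewrite t0k ?tk //; last by lia.
    by apply: contraNneq outi => <-.
  have [||||t1 [f1 w1 k1]] := IHg _ _ t0 [:: n, out & inp] n.+2 n.+3 ug.
  - exact: mapt0.
  - by rewrite /= inpN; lia.
  - by [].
  - rewrite !inE !negb_or; apply/and3P; split; try lia.
    by apply/negP => /(allP inpn); lia.
  have [|||t2 [f2 w2 k2]] := @exec_copy n.+2 out n.+3 t1; try lia.
  have [|||||t3 [f3 w3 k3]] := IH i.+1 (upd t2 n (t2 n).+1).
  - by lia.
  - by rewrite upd_other ?k2 ?k1 /t0 ?upd_same //; lia.
  - by rewrite upd_same k2 ?k1 ?t0k ?ti //; lia.
  - by rewrite upd_other ?w2 //; lia.
  - by move=> r rn ro; rewrite upd_other ?k2 ?k1 ?t0k ?tk //; lia.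
  exists t3; split=> //; apply: ExLoopS tm _ f3.
  exact: ExSeq f1 (ExSeq f2 (ExInc _ _)).
have [|||||s4 [e4 o4 k4]] := loop (thead v) 0 s3.
- by [].
- by rewrite z3 hv p2 ?p1 //; lia.
- by rewrite p3 //; lia.
- by rewrite p3 ?p2 //; lia.
- exact: keep3.
exists s4; split=> //=.
by do 3![apply: ExSeq; first by eassumption].
Qed.

(** Register [n.+1] is a flag, lowered at each pass and raised again when the value left in [n] is
    nonzero. The inner loop clears [n] in its body, so it acts as a conditional, and the outer loop
    stops at the first zero. *)
Lemma compile_mu k (f : recfun k.+1) : compiles f -> compiles (RMu f).
Proof.
move=> IHf v y s inp out n /= [fpos f0] evi inpn outn outi.
have [|s1 [e1 z1 p1]] := @exec_clear out n.+2 s; first by lia.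
have [|s2 [e2 z2 p2]] := @exec_clear n.+1 n.+2 s1; first by lia.
set s3 := upd s2 n.+1 (s2 n.+1).+1.
have s3k r : r < n -> s3 r = s1 r.
  by move=> rn; rewrite /s3 upd_other ?p2 //; lia.
have inpN : all (fun r => r < n.+2) (out :: inp).
  by apply/andP; split; [lia | apply: sub_all inpn => q /= ?; lia].
have body i z t : t n.+1 = 1 -> t out = i ->
    (forall r, r < n -> r != out -> t r = s r) ->
    computes f [tuple of i :: v] z ->
    exists t', [/\ exec (compile f (out :: inp) n n.+2) (upd t n.+1 0) t',
      [/\ t' n = z, t' n.+1 = 0 & t' out = i] &
      forall r, r < n -> r != out -> t' r = s r].
  move=> t1 ti tk fz; set t0 := upd t n.+1 0.
  have t0k r : r < n -> t0 r = t r by move=> rn; rewrite /t0 upd_other //; lia.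
  have [||||t' [f1 w1 k1]] := IHf _ _ t0 (out :: inp) n n.+2 fz.
  - rewrite /= t0k // ti -evi; congr (_ :: _); apply/eq_in_map => r ri.
    have rn := allP inpn _ ri.
    by rewrite t0k // tk //; apply: contraNneq outi => <-.
  - exact: inpN.
  - by [].
  - rewrite inE negb_or; apply/andP; split; first by lia.
    by apply/negP => /(allP inpn); lia.
  exists t'; split=> // [|r rn ro]; first split=> //.
  - by rewrite k1 ?/t0 ?upd_same //; lia.
  - by rewrite k1 ?t0k //; lia.
  - by rewrite k1 ?t0k ?tk //; lia.
have loop m i t : i + m = y -> t n.+1 = 1 -> t out = i ->
    (forall r, r < n -> r != out -> t r = s r) ->
    exists t', [/\ exec (Loop n.+1 (Seq (compile f (out :: inp) n n.+2)
          (Loop n (Seq (clear n n.+2) (Seq (Inc out) (Inc n.+1)))))) t t',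
      t' out = y & forall r, r < n -> r != out -> t' r = s r].
  elim: m i t => [|m IH] i t im t1 ti tk.
    rewrite addn0 in im; rewrite -im in f0.
    have [t' [f1 [w1 w2 w3] k1]] := body i 0 t t1 ti tk f0.
    exists t'; split=> //; last by rewrite w3.
    by apply: ExLoopS t1 (ExSeq f1 _) (ExLoop0 _ _) => //; exact: ExLoop0.
  have [|z fz] := fpos i; first by lia.
  have [t' [f1 [w1 w2 w3] k1]] := body i z.+1 t t1 ti tk fz.
  have [|t2 [f2 x2 k2]] := @exec_clear n n.+2 (upd t' n z); first by lia.
  have t2k r : r < n -> t2 r = t' r.
    by move=> rn; rewrite k2 ?upd_other //; lia.
  set t3 := upd t2 out (t2 out).+1; set t4 := upd t3 n.+1 (t3 n.+1).+1.
  have [||||t5 [f5 x5 k5]] := IH i.+1 t4.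
  - by lia.
  - by rewrite /t4 upd_same /t3 upd_other ?k2 ?upd_other ?w2 //; lia.
  - by rewrite /t4 upd_other ?/t3 ?upd_same ?t2k ?w3 //; lia.
  - by move=> r rn ro; rewrite /t4 upd_other ?/t3 ?upd_other ?t2k ?k1 //; lia.
  exists t5; split=> //; apply: ExLoopS t1 (ExSeq f1 _) f5.
  apply: ExLoopS w1 (ExSeq f2 (ExSeq (ExInc _ _) (ExInc _ _))) _.
  by apply: ExLoop0; rewrite !upd_other //; lia.
have [||||s4 [e4 o4 k4]] := loop y 0 s3.
- by [].
- by rewrite /s3 upd_same z2.
- by rewrite s3k.
- by move=> r rn ro; rewrite s3k // p1 //; lia.
exists s4; split=> //.
by do 3![apply: ExSeq; first by (eassumption || exact: ExInc)].
Qed.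

Lemma compile_comp k m (f : recfun m) (g : 'I_m -> recfun k) :
  compiles f -> (forall i, compiles (g i)) -> compiles (RComp f g).
Proof.
move=> IHf IHg v y s inp out n /= [w [gw fw]] evi inpn outn outi.
have inpN : all (fun r => r < n + m) inp.
  by apply: sub_all inpn => q qn; rewrite ltn_addr.
suff [s' []] : exists s', [/\ exec (foldr Seq (compile f (iota n m) out (n + m))
        [seq compile (g i) inp (n + i) (n + m) | i <- enum 'I_m]) s s',
    s' out = y & forall r, r < n -> r != out -> s' r = s r].
  by exists s'.
(* Induction on the list of components still to be computed: those outside the list already have
   their value in register [n + i]. *)
have : forall i : 'I_m, i \notin enum 'I_m -> s (n + i) = tnth w i.
  by move=> i; rewrite mem_enum.
have : forall r, r < n -> s r = s r by [].
elim: (enum 'I_m) {1 3 4}s => [|i l IH] t tk tw /=.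
  have [||||s' [e' o' k']] := IHf w y t (iota n m) out (n + m) fw.
  - apply: (@eq_from_nth _ 0); first by rewrite size_map size_iota size_tuple.
    move=> j; rewrite size_map size_iota => jm.
    rewrite (nth_map 0) ?size_iota // nth_iota // (tw (Ordinal jm)) //.
    by rewrite (tnth_nth 0).
  - by apply/allP => r; rewrite mem_iota => /andP[].
  - by rewrite ltn_addr.
  - by rewrite mem_iota leqNgt outn.
  by exists s'; split=> // r rn ro; rewrite k' ?ltn_addr // tk.
have [||||t1 [e1 o1 k1]] := IHg i v _ t inp (n + i) (n + m) (gw i).
- rewrite -evi; apply/eq_in_map => r ri; exact: tk (allP inpn _ ri).
- exact: inpN.
- by rewrite ltn_add2l.
- by apply/negP => /(allP inpn); rewrite ltnNge leq_addr.
have [||s' [e' o' k']] := IH t1.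
- move=> r rn; rewrite k1 ?tk // ?ltn_addr //.
  by rewrite neq_ltn ltn_addr.
- move=> j jl; have [-> // | ji] := eqVneq j i.
  rewrite k1 ?ltn_add2l ?eqn_add2l // tw // inE negb_or jl andbT //.
by exists s'; split=> //; apply: ExSeq e1 e'.
Qed.

Lemma compileP k (f : recfun k) : compiles f.
Proof.
elim: f => {k} [k||k i|k m f IHf g IHg|k f IHf g IHg|k f IHf].
- move=> v y s inp out n /= -> evi inpn outn outi.
  have on : out != n by rewrite neq_ltn outn.
  have [s' [e z p]] := exec_clear s on.
  by exists s'; split=> // r rn ro; rewrite p // neq_ltn rn.
- move=> v y s inp out n /= -> evi inpn outn outi.
  case: inp evi inpn outi => [e|x inp evi /andP[xn _]].
    by have := size_tuple v; rewrite -e.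
  rewrite inE negb_or eq_sym => /andP[xo _].
  have [s' [e z p]] := @exec_copy x out n s xn outn xo.
  exists (upd s' out (s' out).+1); split.
  + exact: ExSeq e (ExInc _ _).
  + by rewrite upd_same z; case: v evi => -[|a w] //= i [-> _].
  + by move=> r rn ro; rewrite upd_other ?p.
- move=> v y s inp out n /= -> evi inpn outn outi.
  have si : i < size inp by rewrite -(size_map s) evi size_tuple.
  have xin := mem_nth 0 si.
  have [|s' [e z p]] := @exec_copy (nth 0 inp i) out n s (allP inpn _ xin) outn.
    by apply: contraNneq outi => <-.
  by exists s'; split=> //; rewrite z (tnth_nth 0) -evi (nth_map 0).
- exact: compile_comp.
- exact: compile_prec.
- exact: compile_mu.
Qed.

(** * Counter machines *)

(* [OInit r] is never enabled: it only serves to carry the initial contents of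
   register [r], as a number of fictitious past occurrences. *)
Variant op := OInc of nat | ODec of nat | OZero of nat | OInit of nat.

Lemma op_comparable : comparable op.
Proof. by move=> o o'; rewrite /decidable; decide equality; apply: eq_comparable. Qed.

HB.instance Definition _ := hasDecEq.Build op (compareP op_comparable).

Definition trans := (nat * nat * op)%type.
Definition src (t : trans) : nat := t.1.1.
Definition tgt (t : trans) : nat := t.1.2.
Definition opr (t : trans) : op := t.2.
Definition conf := (nat * (nat -> nat))%type.

Definition op_ok o (s : nat -> nat) :=
  match o with
  | OInc _ => true
  | ODec r => 0 < s r
  | OZero r => s r == 0
  | OInit _ => false
  end.

Definition op_upd o (s : nat -> nat) :=
  match o with
  | OInc r => upd s r (s r).+1
  | ODec r => upd s r (s r).-1
  | OZero _ | OInit _ => s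
  end.

Definition enabled (t : trans) (c : conf) := (src t == c.1) && op_ok (opr t) c.2.
Definition fire (c : conf) (t : trans) : conf := (tgt t, op_upd (opr t) c.2).

Fixpoint runs (c : conf) (w : seq trans) :=
  if w is t :: w' then enabled t c && runs (fire c t) w' else true.

Lemma runs_cat c w w' : runs c (w ++ w') = runs c w && runs (foldl fire c w) w'.
Proof. by elim: w c => //= t w IH c; rewrite IH andbA. Qed.

Definition deterministic (ts : seq trans) := forall c t t',
  t \in ts -> t' \in ts -> enabled t c -> enabled t' c -> t = t'.

Definition stuck (ts : seq trans) c := forall t, t \in ts -> ~~ enabled t c.

(** By determinism one of the two runs is a prefix of the other, and a run that ends stuck has no
    proper extension. *)
Lemma deterministic_stuck ts c w w' : deterministic ts ->
  {subset w <= ts} -> runs c w -> stuck ts (foldl fire c w) ->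
  {subset w' <= ts} -> runs c w' -> stuck ts (foldl fire c w') ->
  foldl fire c w = foldl fire c w'.
Proof.
move=> det; elim: w w' c => [|t w IH] [|t' w'] c //= sw.
- by move=> _ st sw' /andP[en _]; have := st t'; rewrite en sw' ?mem_head => // /(_ isT).
- by move=> /andP[en _] _ _ _ st; have := st t; rewrite en sw ?mem_head => // /(_ isT).
move=> /andP[en r] st sw' /andP[en' r'] st'.
have ett : t = t' by apply: det en en'; [apply: sw | apply: sw']; rewrite mem_head.
rewrite -ett in r' st' *; apply: IH => // x xw; [apply: sw | apply: sw'].
  by rewrite inE xw orbT.
by rewrite inE xw orbT.
Qed.

Fixpoint len c :=
  match c with
  | Inc _ => 1
  | Seq c1 c2 => len c1 + len c2
  | Loop _ c => (len c).+1
  end.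

(* The code of [c] with entry point [a] and exit point [b]. *)
Fixpoint code c a b : seq trans :=
  match c with
  | Inc r => [:: (a, b, OInc r)]
  | Seq c1 c2 => code c1 a (a + len c1) ++ code c2 (a + len c1) b
  | Loop r c => [:: (a, a.+1, ODec r), (a, b, OZero r) & code c a.+1 a]
  end.

(** This keeps the source points of different parts of a program apart, on which determinism
    rests. *)
Lemma code_src c a b t : t \in code c a b -> a <= src t < a + len c.
Proof.
elim: c a b => [r|c1 IH1 c2 IH2|r c IH] a b /=.
- by rewrite inE => /eqP->; rewrite /src /=; lia.
- by rewrite mem_cat => /orP[/IH1|/IH2] /=; lia.
- by rewrite !inE => /or3P[/eqP->|/eqP->|/IH]; rewrite /src /=; lia.
Qed.

Lemma code_deterministic c a b : deterministic (code c a b).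
Proof.
elim: c a b => [r|c1 IH1 c2 IH2|r c IH] a b /= x t t'.
- by rewrite !inE => /eqP-> /eqP->.
- have src12 u u' : u \in code c1 a (a + len c1) ->
      u' \in code c2 (a + len c1) b -> enabled u x -> enabled u' x -> False.
    by move=> /code_src su /code_src su' /andP[/eqP eu _] /andP[/eqP eu' _]; lia.
  rewrite !mem_cat => /orP[]tc /orP[]tc' en en'.
  + exact: IH1 tc tc' en en'.
  + by case: (src12 _ _ tc tc').
  + by case: (src12 _ _ tc' tc).
  + exact: IH2 tc tc' en en'.
- have srcN (u : trans) : u \in code c a.+1 a -> enabled u x -> x.1 != a.
    by move=> /code_src su /andP[/eqP eu _]; lia.
  rewrite !inE => /or3P[/eqP->|/eqP->|tc] /or3P[/eqP->|/eqP->|tc'] //.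
  + by case/andP=> _ + /andP[_]; rewrite /opr /=; lia.
  + by case/andP=> /eqP xa _ /(srcN _ tc'); rewrite -xa eqxx.
  + by case/andP=> _ + /andP[_]; rewrite /opr /=; lia.
  + by case/andP=> /eqP xa _ /(srcN _ tc'); rewrite -xa eqxx.
  + by move=> /(srcN _ tc) + /andP[/eqP xa _]; rewrite -xa eqxx.
  + by move=> /(srcN _ tc) + /andP[/eqP xa _]; rewrite -xa eqxx.
  + exact: IH tc tc'.
Qed.

Lemma exec_code c s s' : exec c s s' -> forall a b, exists w : seq trans,
  [/\ {subset w <= code c a b}, runs (a, s) w & foldl fire (a, s) w = (b, s')].
Proof.
elim=> {c s s'} [r s|c1 c2 s1 s2 s3 _ IH1 _ IH2|r c s sr|r c n s1 s2 s3 sr _ IH1 _ IH2] a b.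
- by exists [:: (a, b, OInc r)]; split; rewrite /= /enabled ?eqxx.
- have [w1 [m1 r1 f1]] := IH1 a (a + len c1).
  have [w2 [m2 r2 f2]] := IH2 (a + len c1) b.
  exists (w1 ++ w2); split; last by rewrite foldl_cat f1.
    by move=> t; rewrite /= !mem_cat => /orP[/m1->|/m2->]; rewrite ?orbT.
  by rewrite runs_cat r1 f1.
- exists [:: (a, b, OZero r)]; split=> //=; last by rewrite /enabled /src /opr /= eqxx sr.
  by move=> t; rewrite !inE => ->; rewrite orbT.
have [w1 [m1 r1 f1]] := IH1 a.+1 a.
have [w2 [m2 r2 f2]] := IH2 a b.
have fs : fire (a, s1) (a, a.+1, ODec r) = (a.+1, upd s1 r n) by rewrite /fire /opr /= sr.
exists ((a, a.+1, ODec r) :: w1 ++ w2); split; last first.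
- by rewrite /= fs foldl_cat f1.
- by rewrite /= fs runs_cat r1 f1 r2 /enabled /src /opr /= eqxx sr.
move=> t; rewrite inE mem_cat => /or3P[/eqP->|/m1 tc|/m2 //].
  exact: mem_head.
by rewrite !inE tc !orbT.
Qed.

(** Source and target coincide, so that the fictitious occurrences do not shift the program
    counter. *)
Definition inits k : seq trans := [seq (0, 0, OInit i) | i <- iota 0 k].

Definition accepting (ts : seq trans) (t : trans) (s : nat -> nat) :=
  exists w : seq trans, {subset w <= rcons ts t} /\ runs (0, s) (rcons w t).

(** * The machine of a recursive function *)

Section Machine.
Variables (k : nat) (g : recfun k).

Definition prog := compile g (iota 0 k) k k.+1.
(** Enabled at the exit of the program only if the output register [k] is zero: acceptance stands
    for the value 0. *)
Definition halt : trans := (len prog, (len prog).+1, OZero k).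
Definition machine := inits k ++ code prog 0 (len prog).

Lemma machine_deterministic : deterministic (rcons machine halt).
Proof.
have initF t c : t \in inits k -> ~ enabled t c.
  by move=> /mapP[i _ ->] /andP[].
have haltF t c : t \in code prog 0 (len prog) -> enabled t c -> ~ enabled halt c.
  move=> /code_src su /andP[/eqP eu _] /andP[/eqP eh _].
  by move: eh; rewrite /halt {1}/src /=; lia.
move=> c t t'; rewrite !mem_rcons !inE !mem_cat.
case/or3P=> [/eqP->|/initF nt|tc]; case/or3P=> [/eqP->|/initF nt'|tc'] // en en'.
- by case: (nt' _ en').
- by case: (haltF _ _ tc' en' en).
- by case: (nt _ en).
- by case: (nt _ en).
- by case: (nt _ en).
- by case: (haltF _ _ tc en en').
- by case: (nt' _ en').
- exact: code_deterministic tc tc' en en'.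
Qed.

Lemma machine_stuck (c : conf) : len prog <= c.1 -> (c.1 = len prog -> c.2 k != 0) ->
  stuck (rcons machine halt) c.
Proof.
move=> lc ck t; rewrite mem_rcons inE mem_cat => /or3P[/eqP->|/mapP[i _ ->]|/code_src].
- by apply/negP => /andP[/eqP e /eqP]; apply/eqP/ck.
- by apply/negP => /andP[].
- by move=> tc; apply/negP => /andP[/eqP e _]; lia.
Qed.

Lemma machine_run (v : k.-tuple nat) y : computes g v y -> exists (w : seq trans) s,
  [/\ {subset w <= machine}, runs (0, nth 0 v) w,
    foldl fire (0, nth 0 v) w = (len prog, s) & s k = y].
Proof.
move=> gy; have [||||s [ex sy _]] := @compileP _ g v y (nth 0 v) (iota 0 k) k k.+1 gy.
- by rewrite -/(mkseq _ _) -{2}(size_tuple v) mkseq_nth.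
- by apply/allP => i; rewrite mem_iota; lia.
- by [].
- by rewrite mem_iota; lia.
have [w [wm wr wf]] := exec_code ex 0 (len prog).
by exists w, s; split=> // t /wm; rewrite mem_cat orbC => ->.
Qed.

Lemma sub_machine (w : seq trans) :
  {subset w <= machine} -> {subset w <= rcons machine halt}.
Proof. by move=> wm t /wm tm; rewrite mem_rcons inE tm orbT. Qed.

Lemma machine_accepting (v : k.-tuple nat) :
  computes g v 0 -> accepting machine halt (nth 0 v).
Proof.
move=> /machine_run[w [s [/sub_machine wm wr wf sk]]]; exists w; split=> //.
by rewrite -cats1 runs_cat wr wf /= /enabled /src /opr /= sk !eqxx.
Qed.

(** A computation with nonzero value gets stuck at the exit point, an accepting run one point
    further; determinism excludes having both. *)
Lemma machine_rejecting (v : k.-tuple nat) y :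
  computes g v y.+1 -> ~ accepting machine halt (nth 0 v).
Proof.
move=> /machine_run[w [s [/sub_machine wm wr wf sk]]] [w' [wm' wr']].
have := @deterministic_stuck _ (0, nth 0 v) w (rcons w' halt) machine_deterministic wm wr.
rewrite wf foldl_rcons => e.
suff: (len prog, s).1 = (len prog).+1 by move=> /= /n_Sn.
rewrite e //.
- by apply: machine_stuck => //=; rewrite sk.
- by move=> t; rewrite mem_rcons inE => /predU1P[->|/wm' //]; rewrite mem_rcons mem_head.
- by apply: machine_stuck; rewrite /fire /tgt /=; lia.
Qed.

End Machine.

(** * An SSM checking linear tests on letter counts *)

Local Open Scope ring_scope.

Definition posp m n (x : 'M[int]_(m, n)) : 'M[int]_(m, n) := map_mx (Num.max 0) x.
Notation ratz := (map_mx (intr : int -> rat)).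

(** With zero weights the gate ignores its input; the bias is nonnegative, so a final relu leaves it
    unchanged and both output kinds agree. *)
Definition id_gate d : fnn d (d * d) := FOut 0 (mxvec 1%:M)^T.

(* Applying relu before an identity output layer makes the value nonnegative, so
   that it does not depend on the output kind. *)
Definition relu_net m n (A : 'M[int]_(n, m)) (b : 'cV[int]_n) : fnn m n :=
  FHid (ratz A) (ratz b) (FOut 1%:M 0).

Section IntegerNetworks.
Variable R : realType.
Notation realz := (map_mx (intr : int -> R)).

Lemma ratz_ratr m n (A : 'M[int]_(m, n)) : map_mx ratr (ratz A) = realz A.
Proof. by apply/matrixP=> i j; rewrite !mxE ratr_int. Qed.

(** Weights and inputs being integers, the real semantics reduces to a computation over [int]. *)
Lemma affine_realz m n (A : 'M[int]_(n, m)) b x :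
  affine (ratz A) (ratz b) (realz x) = realz (A *m x + b).
Proof. by rewrite /affine !ratz_ratr map_mxD map_mxM. Qed.

Lemma relu_realz m n (x : 'M[int]_(m, n)) : map_mx (@relu R) (realz x) = realz (posp x).
Proof.
by apply/matrixP=> i j; rewrite !mxE /relu !maxEle ler0z; case: ifP.
Qed.

Lemma relu_netE o m n (A : 'M[int]_(n, m)) b x :
  net_eval o (relu_net A b) (realz x) = realz (posp (A *m x + b)).
Proof.
rewrite /= affine_realz relu_realz /affine map_mx1 map_mx0 mul1mx addr0.
case: o => //; rewrite relu_realz; congr (map_mx _ _); apply/matrixP=> i j.
by rewrite !mxE; lia.
Qed.

Lemma id_gateE o d (l : ssm_layer d) (x : 'cV[R]_d) :
  gate_net l = id_gate d -> gate o l x = 1%:M.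
Proof.
rewrite /gate => ->; rewrite /= /affine map_mx0 mul0mx add0r.
have e : map_mx ratr (mxvec 1%:M)^T = (mxvec 1%:M)^T :> 'cV[R]_(d * d).
  by rewrite -map_trmx map_mxvec map_mx1.
case: o; rewrite e ?trmxK ?mxvecK //; rewrite -[RHS]mxvecK.
congr vec_mx; apply/matrixP => i j; rewrite !mxE.
rewrite ord1 /relu; case/mxvec_indexP: j => a b; rewrite mxvecE mxE maxEle.
by case: eqP => _; rewrite ?lexx ?ler01.
Qed.

Lemma step_realz o d (l : ssm_layer d) A b (h x : 'cV[int]_d) :
  gate_net l = id_gate d -> inc_net l = relu_net A b ->
  gate o l (realz x) *m realz h + inc o l (realz x) = realz (h + posp (A *m x + b)).
Proof.
by move=> lg li; rewrite id_gateE // mul1mx /inc li relu_netE map_mxD.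
Qed.

End IntegerNetworks.

Definition last_net d (fin : 'I_d) : fnn d 1 := FOut (ratz (delta_mx 0 fin)) (ratz 0).

Section TestSSM.
Variables (d m : nat) (L : 'M[int]_(m, d)) (b : 'cV[int]_m) (W : 'M[int]_(d, m)).
Variables (H0 : 'cV[int]_d) (fin : 'I_d).
Hypothesis W_ge0 : forall i j, 0 <= W i j.

(* The state is the vector H of letter counts, and the output on letter a is
   relu (e_a - W relu (L H + b)), with H taken before reading a. *)
Definition test_layer := SSMLayer (ratz H0) (id_gate d) (relu_net 1%:M 0)
  (FHid (ratz (col_mx (row_mx L (- L)) (row_mx 0 1%:M))) (ratz (col_mx b 0))
        (FOut (ratz (row_mx (- W) 1%:M)) (ratz 0))).

(* Every coordinate of the state counts the failures of the first layer. *)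
Definition error_layer := SSMLayer (ratz 0) (id_gate d)
  (relu_net (const_mx (-1)) (const_mx 1))
  (FOut (ratz (row_mx (- 1%:M) 1%:M)) (ratz 0)).

Definition letter (a : 'I_d) : 'cV[int]_d := delta_mx a 0.

Definition test_ssm := @SSM d d [ffun a => ratz (letter a)]
  [:: test_layer; error_layer] (last_net fin).

(** Row [a] of [W] selects the tests of letter [a], a test being a coordinate of [L *m H + b] that
    should be at most 0. As [W] is nonnegative, violations cannot cancel. *)
Definition passes H a := (W *m posp (L *m H + b)) a 0 == 0.

Fixpoint passes_all H w :=
  if w is a :: w' then passes H a && passes_all (H + letter a) w' else true.

Fixpoint test_outs H w :=
  if w is a :: w' then
    (if passes H a then letter a else 0) :: test_outs (H + letter a) w'
  else [::].

Fixpoint error_outs (e : nat) (w : seq 'I_d) H :=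
  if w is a :: w' then
    let e' := (e + ~~ passes H a)%N in
    posp ((if passes H a then letter a else 0) - const_mx e'%:Z)
      :: error_outs e' w' (H + letter a)
  else [::].

Lemma penalty_ge0 (x : 'cV[int]_m) i : 0 <= (W *m posp x) i 0.
Proof.
by rewrite mxE; apply: sumr_ge0 => j _; rewrite mulr_ge0 // mxE le_max lexx.
Qed.

(** Integrality matters: a nonzero penalty at [a] is at least 1 and wipes out the 1 of the letter.
    All other coordinates are at most 0 before relu. *)
Lemma test_outE H a :
  posp (letter a - W *m posp (L *m H + b)) = if passes H a then letter a else 0.
Proof.
rewrite /passes; move: (W *m _) (penalty_ge0 (L *m H + b)) => V V_ge0.
apply/matrixP => i j; rewrite ord1 !mxE; move: (V_ge0 i).
have [<-|ia] := eqVneq i a.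
  by move: (V i 0) => p; case: ifP; rewrite !mxE ?eqxx /=; lia.
by move: (V i 0) => p; case: ifP; rewrite !mxE ?(negPf ia) /=; lia.
Qed.

(** The coordinates sum to 1 after a passed test and to 0 after a failed one, so 1 minus the sum is
    the number of new failures. *)
Lemma error_incE (z : bool) a :
  posp (const_mx (-1) *m (if z then letter a else 0) + const_mx 1) =
    const_mx (~~ z : nat)%:Z :> 'cV[int]_d.
Proof.
apply/matrixP => i j; rewrite mxE mxE [X in _ + X]mxE [RHS]mxE.
case: z; last by rewrite mulmx0 mxE.
suff -> : (const_mx (-1) *m letter a) i j = -1 :> int by [].
rewrite mxE (bigD1 a) //= big1 ?addr0 => [|k ka].
  by rewrite !mxE ord1 !eqxx mulr1.
by rewrite !mxE (negPf ka) mulr0.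
Qed.

Variables (R : realType) (o : output_kind).
Notation realz := (map_mx (intr : int -> R)).

Lemma test_layerE H w :
  layer_from o test_layer (realz H) [seq realz (letter a) | a <- w] =
    [seq realz z | z <- test_outs H w].
Proof.
elim: w H => //= a w IH H.
have posl : posp (letter a) = letter a.
  by apply/matrixP => i j; rewrite !mxE; case: (_ && _).
rewrite (@step_realz R o d test_layer 1%:M 0) // mul1mx addr0 posl IH; congr (_ :: _).
rewrite /phi /fnn_eval /= -map_col_mx affine_realz relu_realz affine_realz relu_realz.
congr (map_mx _ _); rewrite -test_outE.
rewrite mul_col_mx !mul_row_col mul0mx add0r mul1mx add_col_mx addr0.
rewrite /posp map_col_mx mul_row_col addr0 mul1mx mulNmx addrC.
(* The state already counts [a]; the block [- L] removes it, so the tests bear on [H] before the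
   letter is read. *)
by rewrite mulNmx mulmxDr addrK [map_mx _ (letter a)]posl.
Qed.

Lemma error_layerE (e : nat) w H :
  layer_from o error_layer (realz (const_mx e%:Z)) [seq realz z | z <- test_outs H w] =
    [seq realz z | z <- error_outs e w H].
Proof.
elim: w e H => //= a w IH e H.
rewrite (@step_realz R o d error_layer (const_mx (-1)) (const_mx 1)) //.
have -> : const_mx e%:Z + posp (const_mx (-1) *m (if passes H a then letter a else 0)
   + const_mx 1) = const_mx (e + ~~ passes H a)%N%:Z :> 'cV[int]_d.
  by rewrite error_incE; apply/matrixP => i j; rewrite !mxE PoszD.
rewrite IH; congr (_ :: _).
rewrite /phi /fnn_eval /= -map_col_mx affine_realz relu_realz.
by rewrite mul_row_col mulNmx !mul1mx addr0 addrC.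
Qed.

(** The failure count never decreases and is subtracted from the last letter, so even an early
    failure keeps the output below 1. *)
Lemma error_outs_last (e : nat) a w H z0 :
  (posp (last z0 (error_outs e (a :: w) H)) fin 0 == 1) =
  [&& e == 0%N, passes_all H (a :: w) & last a w == fin].
Proof.
elim: w e a H z0 => [|a' w IH] e a H z0.
  rewrite /= !mxE andbT; case: (passes H a); rewrite !mxE ?[fin == _]eq_sym ?eqxx /=.
    by rewrite addn0 andbT; case: eqP; rewrite ?andbF ?andbT /=; lia.
  by rewrite addn1 andbF; lia.
apply: etrans (IH (e + ~~ passes H a)%N a' (H + letter a) z0) _ => /=.
by case: passes; rewrite ?addn0 ?andbA ?addn1 ?andbF.
Qed.

Lemma test_ssm_sat :
  ssm_sat R o test_ssm <-> exists w, passes_all H0 (rcons w fin).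
Proof.
have valE a w : @ssm_value R o test_ssm (a :: w) = Some 1 <->
    passes_all H0 (a :: w) && (last a w == fin).
  rewrite /ssm_value; set xs := map _ _.
  have -> : xs = [seq realz (letter a) | a <- a :: w].
    by apply: eq_map => x /=; rewrite ffunE ratz_ratr.
  rewrite -[foldl _ _ _]/(layer_run o error_layer (layer_run o test_layer _)).
  rewrite /layer_run !ratz_ratr test_layerE.
  have -> : 0 = const_mx 0%N%:Z :> 'cV[int]_d by apply/matrixP => i j; rewrite !mxE.
  rewrite error_layerE.
  have := error_outs_last 0 a w H0 0.
  case E: (error_outs _ _ _) => [|z zs] //.
  rewrite [last _ _]/= eqxx andTb => <-; rewrite map_cons last_map.
  rewrite /fnn_eval /= affine_realz relu_realz addr0.
  have -> : posp (delta_mx 0 fin *m last z zs) = (posp (last z zs) fin 0)%:M.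
    apply/matrixP => i j; rewrite !ord1 !mxE eqxx mulr1n (bigD1 fin) //= big1 ?addr0.
      by rewrite mxE !eqxx mul1r.
    by move=> k kf; rewrite mxE (negPf kf) andbF mul0r.
  rewrite mxE [_%:M _ _]mxE eqxx mulr1n; split=> [[]|/eqP->//].
  by move/eqP; rewrite -[1]/(1%:~R) eqr_int.
(* The empty word has no value; a nonempty one is split at its last letter. *)
split=> [[[|a w] //]|[w pw]].
  rewrite valE => /andP[pw /eqP lw]; exists (belast a w).
  by rewrite -lw -lastI.
case E: (rcons w fin) => [|a u]; first by case: w E {pw}.
exists (a :: u); apply/valE; rewrite -E pw /=.
by rewrite -(last_rcons a w fin) E.
Qed.

Lemma test_ssm_time_invariant : time_invariant R o test_ssm.
Proof.
have tid (l : ssm_layer d) : gate_net l = id_gate d ->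
    exists A : 'M[R]_d, forall x, gate o l x = A.
  by move=> lg; exists 1%:M => x; apply: id_gateE.
by do 2![apply: List.Forall_cons; first exact: tid].
Qed.

Lemma test_ssm_diagonal : diagonal R o test_ssm.
Proof.
have did (l : ssm_layer d) : gate_net l = id_gate d ->
    forall x : 'cV[R]_d, is_diag_mx (gate o l x).
  by move=> lg x; rewrite id_gateE // scalar_mx_is_diag.
by do 2![apply: List.Forall_cons; first exact: did].
Qed.

End TestSSM.

(** * Counter machines as SSM *)

Definition op_reg o := match o with OInc r | ODec r | OZero r | OInit r => r end.

Definition op_effect o : int :=
  match o with OInc _ | OInit _ => 1 | ODec _ => -1 | OZero _ => 0 end.

(* The operation is enabled iff [op_sign o * x + op_bias o <= 0], where x is the
   contents of its register. *)
Definition op_sign o : int :=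
  match o with OInc _ | OInit _ => 0 | ODec _ => -1 | OZero _ => 1 end.
Definition op_bias o : int :=
  match o with OInc _ | OZero _ => 0 | ODec _ | OInit _ => 1 end.

Section Encoding.
Variables (d : nat) (t : 'I_d -> trans).

Definition pc_delta a : int := (tgt (t a))%:Z - (src (t a))%:Z.
Definition reg_delta r a : int := op_effect (opr (t a)) *+ (op_reg (opr (t a)) == r).

(** Along a run from control point 0 the differences of target and source telescope to the current
    control point. *)
Definition pc_of (H : 'cV[int]_d) : int := \sum_a pc_delta a * H a 0.
Definition reg_of (H : 'cV[int]_d) r : int := \sum_a reg_delta r a * H a 0.

Definition pc_mx : 'M[int]_d := \matrix_(a, a') pc_delta a'.
Definition src_col : 'cV[int]_d := \col_a (src (t a))%:Z.
Definition reg_mx : 'M[int]_d :=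
  \matrix_(a, a') (op_sign (opr (t a)) * reg_delta (op_reg (opr (t a))) a').
Definition bias_col : 'cV[int]_d := \col_a op_bias (opr (t a)).

(** Three tests for each letter: two opposite inequalities force the program counter to be the
    source, and the third says that the operation is enabled. *)
Definition tests_mx := col_mx pc_mx (col_mx (- pc_mx) reg_mx).
Definition tests_col := col_mx (- src_col) (col_mx src_col bias_col).
Definition owner_mx : 'M[int]_(d, d + (d + d)) := row_mx 1%:M (row_mx 1%:M 1%:M).

Lemma owner_mx_ge0 i j : 0 <= owner_mx i j.
Proof.
rewrite !mxE; case: split => [k|k]; first by rewrite mxE; case: eqP.
by rewrite !mxE; case: split => [l|l]; rewrite mxE; case: eqP.
Qed.

Lemma passesE H a : passes tests_mx tests_col owner_mx H a =
  (pc_of H == (src (t a))%:Z) &&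
  (op_sign (opr (t a)) * reg_of H (op_reg (opr (t a))) + op_bias (opr (t a)) <= 0).
Proof.
rewrite /passes /tests_mx /tests_col /owner_mx /posp !mul_col_mx !add_col_mx !map_col_mx.
rewrite !mul_row_col !mul1mx mulNmx.
have pcE : (pc_mx *m H) a 0 = pc_of H.
  by rewrite mxE; apply: eq_bigr => i _; rewrite mxE.
have regE : (reg_mx *m H) a 0 = op_sign (opr (t a)) * reg_of H (op_reg (opr (t a))).
  by rewrite mxE mulr_sumr; apply: eq_bigr => i _; rewrite mxE mulrA.
rewrite -pcE -regE; move: (pc_mx *m H) (reg_mx *m H) => X Y; rewrite !mxE.
by move: (X a 0) (Y a 0) => x y; lia.
Qed.

Definition matches H (c : conf) := pc_of H = c.1%:Z /\ forall r, reg_of H r = (c.2 r)%:Z.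

Lemma matches_passes H c a : matches H c ->
  passes tests_mx tests_col owner_mx H a = enabled (t a) c.
Proof.
case=> Hpc Hreg; rewrite passesE Hpc Hreg /enabled; congr (_ && _).
  by rewrite eq_sym.
by case: (opr (t a)) => r /=; lia.
Qed.

Lemma matches_fire H c a : matches H c -> enabled (t a) c ->
  matches (H + letter a) (fire c (t a)).
Proof.
have sumD (F : 'I_d -> int) : \sum_i F i * (H + letter a) i 0 = \sum_i F i * H i 0 + F a.
  under eq_bigr => i _ do rewrite mxE mulrDr.
  rewrite big_split /=; congr (_ + _); rewrite (bigD1 a) //= big1 ?addr0 ?mxE ?eqxx ?mulr1 //.
  by move=> i ia; rewrite mxE (negPf ia) mulr0.
case=> Hpc Hreg /andP[/eqP sa b]; split=> [|r].
  by rewrite /pc_of sumD -/(pc_of H) Hpc /pc_delta -sa /=; lia.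
rewrite /reg_of sumD -/(reg_of H r) Hreg /reg_delta.
move: b; rewrite [(fire _ _).2]/=; case: (opr (t a)) => q //= ok.
- by rewrite /upd [r == q]eq_sym; case: eqP => [->|_] /=; lia.
(* Enabledness makes the register positive, so the truncated predecessor is the integer effect
   -1. *)
- by rewrite /upd [r == q]eq_sym; case: eqP ok => [->|_] /=; lia.
- by rewrite mul0rn addr0.
Qed.

(** The correspondence has to persist only up to the first failed test, after which both sides are
    false. *)
Lemma matches_passes_all H c w : matches H c ->
  passes_all tests_mx tests_col owner_mx H w = runs c (map t w).
Proof.
elim: w H c => //= a w IH H c Hc; rewrite (matches_passes _ Hc).
by case: (boolP (enabled _ _)) => //= en; apply: IH; apply: matches_fire.
Qed.

End Encoding.

Section MachineSSM.
Variables (k : nat) (g : recfun k).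

Definition nletters := (size (machine g)).+1.
Definition letter_trans (i : 'I_nletters) := nth (halt g) (rcons (machine g) (halt g)) i.
(** The first [k] letters are the [OInit i], so entry [i] loads register [i]; the default 0 fills
    the counts of all real transitions. *)
Definition init_col (v : seq nat) : 'cV[int]_nletters := \col_i (nth 0%N v i)%:Z.

Definition machine_ssm (v : seq nat) :=
  test_ssm (tests_mx letter_trans) (tests_col letter_trans) (owner_mx nletters)
    (init_col v) ord_max.

Lemma nletters_gt : (k < nletters)%N.
Proof. by rewrite ltnS size_cat size_map size_iota leq_addr. Qed.

Lemma init_matches (v : k.-tuple nat) :
  matches letter_trans (init_col v) (0%N, nth 0%N v).
Proof.
have small (i : 'I_nletters) : (i < k)%N -> letter_trans i = (0%N, 0%N, OInit i).
  move=> ik; rewrite /letter_trans nth_rcons nth_cat size_cat size_map size_iota.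
  by rewrite ltn_addr // ik (nth_map 0%N) ?size_iota // nth_iota.
have large i : (k <= i)%N -> nth 0%N v i = 0%N.
  by move=> ki; rewrite nth_default // size_tuple.
split=> [|r].
  rewrite /pc_of big1 // => i _; rewrite mxE.
  have [ik|/large->] := ltnP i k; last by rewrite mulr0.
  by rewrite /pc_delta small // subrr mul0r.
rewrite /reg_of; have [rk|kr] := ltnP r k; last first.
  rewrite /= large // big1 // => i _; rewrite mxE.
  have [ik|/large->] := ltnP i k; last by rewrite mulr0.
  rewrite /reg_delta small //= /opr /= (_ : (i == r :> nat) = false) ?mul0r //.
  by lia.
have rn := ltn_trans rk nletters_gt.
rewrite (bigD1 (Ordinal rn)) //= big1 => [|i ir].
  by rewrite mxE /reg_delta small //= /opr /= eqxx mul1r addr0.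
rewrite mxE; have [ik|/large->] := ltnP i k; last by rewrite mulr0.
by rewrite /reg_delta small //= /opr /= (_ : (i == r :> nat) = false) ?mul0r //; apply/negbTE.
Qed.

Lemma machine_ssm_sat R o (v : k.-tuple nat) :
  ssm_sat R o (machine_ssm v) <-> accepting (machine g) (halt g) (nth 0%N v).
Proof.
have haltE : letter_trans ord_max = halt g by rewrite /letter_trans nth_rcons ltnn eqxx.
have runsE w := matches_passes_all w (init_matches v).
rewrite test_ssm_sat; last exact: owner_mx_ge0.
split=> [[w]|[w [wm wr]]].
  rewrite runsE map_rcons haltE => wr; exists (map letter_trans w); split=> //.
  by move=> _ /mapP[i _ ->]; rewrite mem_nth // size_rcons ltn_ord.
(* Each transition is read back as the first letter that carries it. *)
exists [seq inord (index x (rcons (machine g) (halt g))) | x <- w].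
rewrite runsE map_rcons haltE -map_comp map_id_in // => x /wm xm.
by rewrite /= /letter_trans inordK ?nth_index //; rewrite -index_mem size_rcons in xm.
Qed.

End MachineSSM.

(** * The Goedel number of the SSM of a machine *)

(** The code of a matrix row whose only entry is the rational n/1; the 2 is [code_int 1], for the
    denominator. *)
Definition code_entry n := CodeSeq.code [:: CodeSeq.code [:: n.*2; 2%N]].

Lemma code_init_col d (v : seq nat) : (size v <= d)%N ->
  code_mx (ratz (\col_(i < d) (nth 0%N v i)%:Z)) =
    CodeSeq.code [seq code_entry n | n <- v ++ nseq (d - size v) 0%N].
Proof.
move=> vd; rewrite /code_mx; congr CodeSeq.code.
have -> : v ++ nseq (d - size v) 0%N = [seq nth 0%N v (nat_of_ord i) | i <- enum 'I_d].
  apply: (@eq_from_nth _ 0%N) => [|i].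
    by rewrite size_cat size_nseq size_map size_enum_ord subnKC.
  rewrite size_cat size_nseq subnKC // => id.
  rewrite (nth_map (Ordinal id)) ?size_enum_ord // nth_enum_ord // nth_cat.
  by case: ltnP => // vi; rewrite nth_nseq if_same nth_default.
rewrite -[RHS]map_comp; apply: eq_map => i; rewrite enum_ordSl enum_ord0 /=.
by rewrite !mxE /code_entry /code_rat numq_int denq_int.
Qed.

Arguments CodeSeq.code : simpl never.
Arguments code_cons : simpl never.

Definition emb_code d := CodeSeq.code [seq code_mx (ratz (letter a)) | a <- enum 'I_d].

Definition test_layer_code d m (L : 'M_(m, d)) b W :=
  let l := test_layer L b W 0 in
  CodeSeq.code [:: code_fnn (gate_net l); code_fnn (inc_net l); code_fnn (phi_net l)].

(** This isolates [H0], through which alone the input of the machine enters the Goedel number. *)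
Lemma code_test_ssm d m (L : 'M_(m, d)) b W H0 fin :
  code_ssm (test_ssm L b W H0 fin) =
  code_cons d (code_cons d (code_cons (emb_code d) (code_cons
    (code_cons (code_cons (code_mx (ratz H0)) (test_layer_code L b W))
       (CodeSeq.code [:: code_layer (error_layer d)]))
    (CodeSeq.code [:: code_fnn (last_net fin)])))).
Proof.
rewrite /code_ssm [alph _]/= [Defs.dim _]/= [layers _]/= [out_net _]/=.
rewrite [map (@code_layer _) _]/= /code_layer /= !code_consE.
congr (code_cons _ (code_cons _ (code_cons _ _))); rewrite /emb_code.
by congr CodeSeq.code; apply: eq_map => a; rewrite ffunE.
Qed.

(* The variables stand both for the initial contents of the six registers and
   for the parts of the Goedel number that do not depend on these contents. *)
Section CodeExpr.
Let x (i : nat) : code_expr 6 := CVar (inord i).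
Let two : code_expr 6 := CSucc (CSucc CZero).
Let entry (e : code_expr 6) := CCons (CCons (CDouble e) (CCons two CZero)) CZero.

Definition ssm_code_expr : code_expr 6 :=
  CCons (x 0) (CCons (x 0) (CCons (x 1) (CCons
    (CCons (CCons
      (foldr (fun i => CCons (entry (x i))) (x 2) (iota 0 6))
      (x 3)) (x 4)) (x 5)))).
End CodeExpr.

(** The third number codes the zeros that pad the six initial counts to length [d], so that the
    expression only has to prepend six entries. *)
Definition ssm_code_parts (g : recfun 6) : 6.-tuple nat :=
  let d := nletters g in
  let L := tests_mx (@letter_trans 6 g) in
  let b := tests_col (@letter_trans 6 g) in
  [tuple d; emb_code d; CodeSeq.code [seq code_entry n | n <- nseq (d - 6) 0%N];
    test_layer_code L b (owner_mx d);
    CodeSeq.code [:: code_layer (error_layer d)];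
    CodeSeq.code [:: code_fnn (last_net (ord_max : 'I_d))]].

Lemma code_eval_ssm (v : 6.-tuple nat) tl (p := nth 0%N v) :
  p 2%N = CodeSeq.code [seq code_entry n | n <- tl] ->
  code_eval v ssm_code_expr =
  code_cons (p 0%N) (code_cons (p 0%N) (code_cons (p 1%N) (code_cons
    (code_cons (code_cons (CodeSeq.code [seq code_entry n | n <- v ++ tl]) (p 3%N))
       (p 4%N))
    (p 5%N)))).
Proof.
have tn i : (i < 6)%N -> tnth v (inord i) = nth 0%N v i.
  by move=> i6; rewrite (tnth_nth 0%N) inordK.
rewrite map_cat /ssm_code_expr /= {}/p.
rewrite (tn 0%N) // (tn 1%N) // (tn 2%N) // (tn 3%N) // (tn 4%N) // (tn 5%N) //.
case/tupleP: v {tn} => a0 v; case/tupleP: v => a1 v; case/tupleP: v => a2 v.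
case/tupleP: v => a3 v; case/tupleP: v => a4 v; case/tupleP: v => a5 v.
by rewrite (tuple0 v) /= !code_consE => <-.
Qed.

(** The self-reference: from its own parts as input, [g] can compute the Goedel number of the very
    SSM that simulates it on this input. *)
Lemma code_machine_ssm (g : recfun 6) :
  code_ssm (machine_ssm g (ssm_code_parts g)) =
    code_eval (ssm_code_parts g) ssm_code_expr.
Proof.
rewrite code_test_ssm code_init_col size_tuple; last by rewrite ltnW // nletters_gt.
rewrite (@code_eval_ssm _ (nseq (nletters g - 6) 0%N)); first by [].
by rewrite /ssm_code_parts.
Qed.

(** * The diagonal argument *)

Theorem theorem3 (R : realType) (o : output_kind) :
  ~ decidable_problem code_ssm
      (fun S : ssm => time_invariant R o S /\ diagonal R o S)
      (fun S : ssm => ssm_sat R o S).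
Proof.
case=> f decf; pose g := RComp f (fun _ : 'I_1 => code_rec ssm_code_expr).
pose v := ssm_code_parts g; pose S := machine_ssm g v.
have gy y : computes f [tuple code_ssm S] y -> computes g v y.
  by rewrite code_machine_ssm; apply: computes_comp1 (computes_code_rec _ _).
(* [S] belongs to the class, so the specification of [f] applies to it, and by self-reference the
   answers of [f] on [S] are values of [g] at [v]. *)
have [sat1 sat0] : (ssm_sat R o S -> computes g v 1%N) /\
    (~ ssm_sat R o S -> computes g v 0%N).
  have [|s1 s0] := decf S; last by split=> [/s1|/s0]; apply: gy.
  by split; [apply: test_ssm_time_invariant | apply: test_ssm_diagonal].
(* Satisfiability would give [g] the value 1 at [v], on which the machine does not accept. *)
have unsat : ~ ssm_sat R o S.
  by move=> sat; apply: (machine_rejecting (sat1 sat)); apply/machine_ssm_sat; exact: sat.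
by apply/unsat/machine_ssm_sat/machine_accepting/sat0.
Qed.
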